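(* Let $\mathfrak{B}$ be a bornology with a closed base on a topological space $X$. The following hold. (1) $X$ satisfies $U_{fin}(\mathcal{O},\mathcal{O}_{\mathfrak{B}})$ if and only if $X$ satisfies $U_{fin}(\Omega,\mathcal{O}_{\mathfrak{B}})$. (2) $X$ satisfies $U_{fin}(\mathcal{O},\Gamma_{\mathfrak{B}})$ if and only if $X$ satisfies $U_{fin}(\Omega,\Gamma_{\mathfrak{B}})$.
   Context: A bornology $\mathfrak{B}$ on $X$ is a family of subsets of $X$ that is closed under taking subsets and finite unions and covers $X$; by standing convention $X\notin\mathfrak{B}$. A base of $\mathfrak{B}$ is a subfamily $\mathfrak{B}_0\subseteq\mathfrak{B}$ such that every $B\in\mathfrak{B}$ is contained in some $B_0\in\mathfrak{B}_0$; it is closed if its members are closed subsets of $X$. $\mathcal{O}$ is the collection of all open covers of $X$. $\Omega$ is the collection of all $\omega$-covers of $X$: open covers $\mathcal{U}$ with $X\notin\mathcal{U}$ such that every finite $F\subseteq X$ is contained in some $U\in\mathcal{U}$. $\mathcal{O}_{\mathfrak{B}}$ is the collection of all open $\mathfrak{B}$-covers of $X$: families $\mathcal{U}$ of open subsets of $X$ with $X\notin\mathcal{U}$ such that every $B\in\mathfrak{B}$ is contained in some $U\in\mathcal{U}$. $\Gamma_{\mathfrak{B}}$ is the collection of all $\gamma_{\mathfrak{B}}$-covers of $X$: infinite covers $\mathcal{U}=\{U_n:n\in\omega\}$ of $X$ by proper open subsets such that for each $B\in\mathfrak{B}$ there is $n_0\in\omega$ with $B\subseteq U_n$ for all $n\ge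 n_0$. For collections $\mathcal{A},\mathcal{B}$ of families of subsets of $X$, $U_{fin}(\mathcal{A},\mathcal{B})$ means that for each sequence $\{\mathcal{U}_n:n\in\omega\}$ of elements of $\mathcal{A}$ there are finite (possibly empty) $\mathcal{V}_n\subseteq\mathcal{U}_n$ ($n\in\omega$) such that $\{\bigcup\mathcal{V}_n:n\in\omega\}\in\mathcal{B}$ or $\bigcup\mathcal{V}_n=X$ for some $n$. *)

(* Defs.v *)
From mathcomp Require Import all_boot all_classical topology.

Set Implicit Arguments.
Unset Strict Implicit.
Unset Printing Implicit Defensive.

Local Open Scope classical_set_scope.

(* The last clause is the convention that the whole space is not bounded.
   [setU_closed] is closure under binary unions. *)
Definition bornology (T : Type) (BB : set (set T)) : Prop :=
  [/\ forall A B, A `<=` B -> BB B -> BB A,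
      setU_closed BB,
      \bigcup_(B in BB) B = setT
    & ~ BB setT].

Definition bornology_base (T : Type) (BB BB0 : set (set T)) : Prop :=
  BB0 `<=` BB /\ forall B, BB B -> exists2 B0, BB0 B0 & B `<=` B0.

Definition has_closed_base (X : topologicalType) (BB : set (set X)) : Prop :=
  exists2 BB0, bornology_base BB BB0 & forall B, BB0 B -> closed B.

Definition open_covers (X : topologicalType) : set (set (set X)) :=
  [set U | (forall O, U O -> open O) /\ \bigcup_(O in U) O = setT].

Definition omega_covers (X : topologicalType) : set (set (set X)) :=
  [set U | [/\ open_covers U, ~ U setT
             & forall F : set X, finite_set F -> exists2 O, U O & F `<=` O]].

Definition open_bornology_covers (X : topologicalType) (BB : set (set X)) :
    set (set (set X)) :=
  [set U | [/\ forall O, U O -> open O, ~ U setT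
             & forall B, BB B -> exists2 O, U O & B `<=` O]].

(* A gamma-cover is an unindexed family, so membership only asks for some
   enumeration; the enumeration may have repetitions. *)
Definition gamma_bornology_covers (X : topologicalType) (BB : set (set X)) :
    set (set (set X)) :=
  [set U | [/\ infinite_set U,
               \bigcup_(O in U) O = setT,
               forall O, U O -> open O /\ O <> setT
             & exists2 u : nat -> set X, U = range u
               & forall B, BB B ->
                   exists n0, forall n, (n0 <= n)%N -> B `<=` u n]].

Definition U_fin (T : Type) (AA BB : set (set (set T))) : Prop :=
  forall U : nat -> set (set T), (forall n, AA (U n)) ->
  exists V : nat -> set (set T),
    (forall n, finite_set (V n) /\ V n `<=` U n) /\
    (BB (range (fun n => \bigcup_(O in V n) O)) \/
     exists n, \bigcup_(O in V n) O = setT).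

(* Main.v *)
Require Import Defs.
From mathcomp Require Import all_boot all_classical topology.

Local Open Scope classical_set_scope.

(** Both equivalences are instances of one fact, valid for every target
    collection [CC]: [U_fin] has the same meaning for open covers as for
    omega-covers ([U_fin_open_omega]).

    Since omega-covers are open covers, only the passage from omega-covers to
    open covers needs an argument.  Let [U n] be open covers.  If one of them
    has a finite subcover, selecting it satisfies the second alternative in
    [U_fin].  Otherwise replace each [U n] by the family of all unions of its
    finite subfamilies: this is an omega-cover, the whole space being excluded
    precisely because there is no finite subcover
    ([finite_unions_omega_cover]).  A finite selection from the enlarged cover
    unfolds to a finite selection from [U n] with the same union
    ([unfold_finite_unions]), and [U_fin] looks at a selection only through its
    union. *)

Definition finite_unions {T : Type} (U : set (set T)) : set (set T) :=
  [set \bigcup_(O in V) O | V in [set V | finite_set V /\ V `<=` U]].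

Lemma omega_covers_sub_open_covers (X : topologicalType) :
  @omega_covers X `<=` @open_covers X.
Proof. by move=> U []. Qed.

Lemma U_fin_subl {T : Type} {AA AA' CC : set (set (set T))} :
  AA' `<=` AA -> U_fin AA CC -> U_fin AA' CC.
Proof. by move=> sAA UAA U AAU; apply: UAA => n; apply: sAA. Qed.

(** For each point of a finite set, one member of the cover containing it is
    enough. *)
Lemma finite_set_sub_finite_unions {T : Type} {U : set (set T)} {F : set T} :
  \bigcup_(O in U) O = setT -> finite_set F ->
  exists2 O, finite_unions U O & F `<=` O.
Proof.
move=> Ucov finF.
have /choice[f fP] : forall x, exists O, U O /\ O x.
  by move=> x; have : setT x by []; rewrite -Ucov => -[O UO Ox]; exists O.
exists (\bigcup_(O in f @` F) O).
  exists (f @` F) => //; split; first exact: finite_image.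
  by move=> _ [x _ <-]; case: (fP x).
by move=> x Fx; exists (f x); [exists x | case: (fP x)].
Qed.

Lemma finite_unions_omega_cover {X : topologicalType} (U : set (set X)) :
  open_covers U -> ~ finite_unions U setT -> omega_covers (finite_unions U).
Proof.
move=> [Uopen Ucov] noFin; split=> //; last first.
  by move=> F; apply: finite_set_sub_finite_unions.
split.
  by move=> _ [V [_ VU] <-]; apply: bigcup_open => O /VU /Uopen.
apply/seteqP; split=> // x _.
have [O UO xO] := finite_set_sub_finite_unions Ucov (finite_set1 x).
by exists O => //; apply: xO.
Qed.

Lemma unfold_finite_unions {T : Type} {U W : set (set T)} :
  finite_set W -> W `<=` finite_unions U ->
  exists V, [/\ finite_set V, V `<=` U &
                \bigcup_(O in V) O = \bigcup_(O in W) O].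
Proof.
move=> finW WU.
have /choice[g gP] : forall O, exists V : set (set T), W O ->
    [/\ finite_set V, V `<=` U & \bigcup_(P in V) P = O].
  move=> O; have [/WU[V [finV VU] VO]|nWO] := pselect (W O).
    by exists V.
  by exists set0.
exists (\bigcup_(O in W) g O); split.
- by apply: bigcup_finite => // O /gP[].
- by move=> P [O /gP[_ gU _]] /gU.
rewrite bigcup_bigcup; apply: eq_bigcupr => O WO.
by have [_ _] := gP _ WO.
Qed.

Lemma U_fin_open_omega (X : topologicalType) (CC : set (set (set X))) :
  U_fin (@open_covers X) CC <-> U_fin (@omega_covers X) CC.
Proof.
split; first exact/U_fin_subl/omega_covers_sub_open_covers.
move=> Uomega U Ucov.
have [[m [V [finV VU] VT]]|noFin] :=
    pselect (exists m, finite_unions (U m) setT).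
  exists (fun n => if n == m then V else set0); split.
    by move=> n; case: eqP => [->|_]; split.
  by right; exists m; rewrite eqxx.
have [|W [WP WC]] := Uomega (fun n => finite_unions (U n)).
  by move=> n; apply: finite_unions_omega_cover => // ?; apply: noFin; exists n.
have /choice[V VP] : forall n, exists V, [/\ finite_set V, V `<=` U n &
    \bigcup_(O in V) O = \bigcup_(O in W n) O].
  by move=> n; have [finW WU] := WP n; apply: unfold_finite_unions.
exists V; split; first by move=> n; have [] := VP n.
have -> : (fun n => \bigcup_(O in V n) O) = (fun n => \bigcup_(O in W n) O).
  by apply/funext => n; have [] := VP n.
by case: WC => [|[n Wn]]; [left | right; exists n; have [_ _ ->] := VP n].
Qed.

Theorem theorem3p8 (X : topologicalType) (BB : set (set X))
    (hBB : bornology BB) (hbase : has_closed_base BB) :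
  (U_fin (@open_covers X) (open_bornology_covers BB) <->
   U_fin (@omega_covers X) (open_bornology_covers BB)) /\
  (U_fin (@open_covers X) (gamma_bornology_covers BB) <->
   U_fin (@omega_covers X) (gamma_bornology_covers BB)).
Proof. by split; apply: U_fin_open_omega. Qed.
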